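(* Let $I$ be an infinite set and $\mathbb T=\{t\in\mathbb C:|t|=1\}$. Let $\prod^1_{i\in I}\mathbb T=\{\alpha\in\prod_{i\in I}\mathbb T:\alpha_i=1\text{ for all but finitely many }i\}$ and let $\varphi:\prod_{i\in I}\mathbb T\to\mathbb T$ be a group homomorphism extending the homomorphism $\varphi_1:\prod^1_{i\in I}\mathbb T\to\mathbb T$, $\varphi_1(\alpha)=\prod_{i\in I}\alpha_i$ (such a $\varphi$ exists). Then $$\Phi(\otimes_{i\in I}\alpha_i):=\varphi(\alpha)\,\lambda([\alpha]_\sim)\qquad\Big(\alpha\in\prod_{i\in I}\mathbb T\Big)$$ gives (by linear extension) a well-defined $^*$-isomorphism $\Phi$ from $\mathbb C^{\otimes I}_{\rm ut}$ onto $\mathbb C[\Omega^{\rm ut}_{I;\mathbb C}]$.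
   Context: $\mathbb C^{\otimes I}=\bigotimes_{i\in I}\mathbb C$ is the vector space with a multilinear (linear in each variable separately) map $\alpha\mapsto\otimes_{i\in I}\alpha_i$ from $\prod_{i\in I}\mathbb C$ through which every multilinear map from $\prod_{i\in I}\mathbb C$ to a vector space factors via a unique linear map (it exists and is unique up to isomorphism). It is a unital commutative $^*$-algebra with $(\otimes\alpha_i)(\otimes\beta_i)=\otimes\alpha_i\beta_i$ and $(\otimes\alpha_i)^*=\otimes\overline{\alpha_i}$. For $\alpha,\beta\in\prod_{i\in I}(\mathbb C\setminus\{0\})$, $\alpha\sim\beta$ means $\alpha_i=\beta_i$ for all but finitely many $i$. $\Omega^{\rm ut}_{I;\mathbb C}=\prod_{i\in I}\mathbb T/\sim$ is a group under coordinatewise multiplication. For $\omega=[\alpha]_\sim$, $\bigotimes^\omega_{i\in I}\mathbb C$ is the span of all $\otimes_{i\in I}\beta_i$ with $\beta\in\prod_{i\in I}\mathbb C$ and $\beta_i=\alpha_i$ for all but finitely many $i$. $\mathbb C^{\otimes I}_{\rm ut}=\bigoplus_{\omega\in\Omega^{\rm ut}_{I;\mathbb C}}\bigotimes^\omega_{i\in I}\mathbb C\subseteq\mathbb C^{\otimes I}$, a unital $^*$-subalgebra, which is the linear span of $\{\otimes_{i\in I}\alpha_i:\alpha\in\prod_{i\in I}\mathbb T\}$. $\mathbb C[G]$ is the group $^*$-algebra of a group $G$, with canonical basis $\{\lambda(g)\}_{g\in G}$. *)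

(* Defs.v *)
From HB Require Import structures.
From mathcomp Require Import all_boot all_order all_algebra finmap.
From mathcomp Require Import all_classical reals complex monalg.

Set Implicit Arguments.
Unset Strict Implicit.
Unset Printing Implicit Defensive.

Import Order.TTheory GRing.Theory Num.Theory.

Local Open Scope classical_set_scope.
Local Open Scope ring_scope.
Local Open Scope quotient_scope.

HB.mixin Record isStarAlgebra (C : numClosedFieldType) A
    of GRing.Algebra C A := {
  star : A -> A;
  starK : involutive star;
  starD : {morph star : x y / x + y};
  starZ : forall (a : C) x, star (a *: x) = a^* *: star x;
  starM : forall x y, star (x * y) = star y * star x
}.

#[short(type="starAlgType")]
HB.structure Definition StarAlgebra (C : numClosedFieldType) :=
  {A of isStarAlgebra C A & GRing.Algebra C A}.

#[short(type="comStarAlgType")]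
HB.structure Definition ComStarAlgebra (C : numClosedFieldType) :=
  {A of StarAlgebra C A & GRing.ComAlgebra C A}.

Definition star_isomorphism (C : numClosedFieldType) (A B : starAlgType C)
    (f : {linear A -> B}) : Prop :=
  [/\ monoid_morphism f, {morph f : x / star x} & bijective f].

(* The *-algebra of a *-monoid; for a group the involution of the *-monoid
   is the inverse, and this is the group *-algebra. The multiplication of malg
   itself is only available over monoids without nontrivial units. *)
Definition gralg (C : numClosedFieldType) (M : starMonoidType) : Type :=
  {malg C[M]}.

Section GroupAlgebra.
Context (C : numClosedFieldType) (M : starMonoidType).
Implicit Types (g : {malg C[M]}) (k : M).

HB.instance Definition _ := GRing.Lmodule.copy (gralg C M) {malg C[M]}.

Definition gralg1 : {malg C[M]} := << 1%g >>.

Definition gralg_mul g1 g2 : {malg C[M]} :=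
  \sum_(k1 <- msupp g1) \sum_(k2 <- msupp g2)
    << g1@_k1 * g2@_k2 *g (k1 * k2)%g >>.

Definition gralg_star g : {malg C[M]} :=
  [malg k in ((fun k => k^-1)%g @` msupp g)%fset => (g@_(k^-1)%g)^*].

Lemma gralg_mulw (d1 d2 : {fset M}) g1 g2 :
  (msupp g1 `<=` d1)%fset -> (msupp g2 `<=` d2)%fset ->
  gralg_mul g1 g2 = \sum_(k1 <- d1) \sum_(k2 <- d2)
    << g1@_k1 * g2@_k2 *g (k1 * k2)%g >>.
Proof.
move=> le_d1 le_d2; rewrite /gralg_mul (big_fset_incl _ le_d1) /=.
  apply/eq_bigr=> k1 _; apply/big_fset_incl => // k _ /mcoeff_outdom ->.
  by rewrite mulr0 monalgU0.
move=> k _ /mcoeff_outdom g1k.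
by rewrite big1 => // k' _; rewrite g1k mul0r monalgU0.
Qed.

Lemma gralg_mulUU c1 c2 k1 k2 :
  gralg_mul << c1 *g k1 >> << c2 *g k2 >> = << c1 * c2 *g (k1 * k2)%g >>.
Proof. by rewrite (gralg_mulw msuppU_le msuppU_le) !big_seq_fset1 !mcoeffUU. Qed.

Lemma gralg_mulDl : left_distributive gralg_mul +%R.
Proof.
move=> g1 g2 g.
rewrite [X in _ = X + _](gralg_mulw (fsubsetUl _ (msupp g2)) (fsubset_refl _)).
rewrite [X in _ = _ + X](gralg_mulw (fsubsetUr (msupp g1) _) (fsubset_refl _)).
rewrite (gralg_mulw (msuppD_le _ _) (fsubset_refl _)).
rewrite -big_split /=; apply/eq_bigr=> k1 _.
rewrite -big_split /=; apply/eq_bigr=> k2 _.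
by rewrite mcoeffD mulrDl monalgUD.
Qed.

Lemma gralg_mulDr : right_distributive gralg_mul +%R.
Proof.
move=> g g1 g2.
rewrite [X in _ = X + _](gralg_mulw (fsubset_refl _) (fsubsetUl _ (msupp g2))).
rewrite [X in _ = _ + X](gralg_mulw (fsubset_refl _) (fsubsetUr (msupp g1) _)).
rewrite (gralg_mulw (fsubset_refl _) (msuppD_le _ _)).
rewrite -big_split /=; apply/eq_bigr => k1 _.
rewrite -big_split /=; apply/eq_bigr => k2 _.
by rewrite mcoeffD mulrDr monalgUD.
Qed.

Lemma malg_ind (P : {malg C[M]} -> Prop) :
  P 0 -> (forall g1 g2, P g1 -> P g2 -> P (g1 + g2)) ->
  (forall c k, P << c *g k >>) -> forall g, P g.
Proof. by move=> P0 PD PU g; rewrite [g]monalgE; elim/big_ind: _. Qed.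

Lemma gralg_mul0g : left_zero 0 gralg_mul.
Proof. by move=> g; rewrite /gralg_mul msupp0 big_seq_fset0. Qed.

Lemma gralg_mulg0 : right_zero 0 gralg_mul.
Proof.
by move=> g; rewrite /gralg_mul msupp0 big1 // => k _; rewrite big_seq_fset0.
Qed.

Lemma gralg_mulA : associative gralg_mul.
Proof.
move=> g1 g2 g3; move: g1 g2 g3; elim/malg_ind => [|x y IHx IHy|c k] g2 g3.
- by rewrite !gralg_mul0g.
- by rewrite !gralg_mulDl IHx IHy.
move: g2 g3; elim/malg_ind => [|x y IHx IHy|c2 k2] g3.
- by rewrite gralg_mulg0 !gralg_mul0g gralg_mulg0.
- by rewrite gralg_mulDl !gralg_mulDr gralg_mulDl IHx IHy.
move: g3; elim/malg_ind => [|x y IHx IHy|c3 k3].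
- by rewrite !gralg_mulg0.
- by rewrite !gralg_mulDr IHx IHy.
by rewrite !gralg_mulUU mulrA mulgA.
Qed.

Lemma gralg_mul1g : left_id gralg1 gralg_mul.
Proof.
elim/malg_ind => [|x y IHx IHy|c k]; first by rewrite gralg_mulg0.
  by rewrite gralg_mulDr IHx IHy.
by rewrite gralg_mulUU mul1r mul1g.
Qed.

Lemma gralg_mulg1 : right_id gralg1 gralg_mul.
Proof.
elim/malg_ind => [|x y IHx IHy|c k]; first by rewrite gralg_mul0g.
  by rewrite gralg_mulDl IHx IHy.
by rewrite gralg_mulUU mulr1 mulg1.
Qed.

Lemma gralg1_neq0 : gralg1 != 0.
Proof. by rewrite monalgU_eq0 oner_eq0. Qed.

HB.instance Definition _ := GRing.Zmodule_isNzRing.Build (gralg C M)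
  gralg_mulA gralg_mul1g gralg_mulg1 gralg_mulDl gralg_mulDr gralg1_neq0.

Lemma gralgMUU (c1 c2 : C) k1 k2 :
  (<< c1 *g k1 >> : gralg C M) * (<< c2 *g k2 >> : gralg C M) =
  << c1 * c2 *g (k1 * k2)%g >>.
Proof. exact: gralg_mulUU. Qed.

Lemma malgZU (a c : C) k : a *: << c *g k >> = << a * c *g k >> :> {malg C[M]}.
Proof. by apply/malgP => l; rewrite mcoeffZ !mcoeffU mulrnAr. Qed.

Lemma gralg_scaleAl (a : C) (x y : gralg C M) : a *: (x * y) = (a *: x) * y.
Proof.
move: x y; elim/malg_ind => [|x y IHx IHy|c k] z.
- by rewrite mul0r !scaler0 mul0r.
- by rewrite mulrDl !scalerDr mulrDl IHx IHy.
move: z; elim/malg_ind => [|x y IHx IHy|c2 k2].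
- by rewrite !mulr0 scaler0.
- by rewrite !mulrDr scalerDr IHx IHy.
by rewrite gralgMUU !malgZU gralgMUU mulrA.
Qed.

HB.instance Definition _ :=
  GRing.Lmodule_isLalgebra.Build C (gralg C M) gralg_scaleAl.

Lemma gralg_scaleAr (a : C) (x y : gralg C M) : a *: (x * y) = x * (a *: y).
Proof.
move: x y; elim/malg_ind => [|x y IHx IHy|c k] z.
- by rewrite !mul0r !scaler0.
- by rewrite !mulrDl !scalerDr IHx IHy.
move: z; elim/malg_ind => [|x y IHx IHy|c2 k2].
- by rewrite mulr0 !scaler0 mulr0.
- by rewrite mulrDr !scalerDr mulrDr IHx IHy.
by rewrite gralgMUU !malgZU gralgMUU mulrCA.
Qed.

HB.instance Definition _ :=
  GRing.Lalgebra_isAlgebra.Build C (gralg C M) gralg_scaleAr.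

Lemma gralg_starE g k : (gralg_star g)@_k = (g@_(k^-1)%g)^*.
Proof.
rewrite mcoeffE; case: ifPn => // /negP kg.
case: msuppP => [kin|_]; last by rewrite conjC0.
by case: kg; apply/imfsetP; exists (k^-1)%g; rewrite ?invgK.
Qed.

Lemma gralg_starU c k : gralg_star << c *g k >> = << c^* *g (k^-1)%g >>.
Proof.
apply/malgP => l; rewrite gralg_starE !mcoeffU (can2_eq (@invgK M) (@invgK M)).
by case: eqP; rewrite ?mulr1n ?mulr0n ?conjC0.
Qed.

Lemma gralg_starK : @involutive (gralg C M) gralg_star.
Proof. by move=> g; apply/malgP => k; rewrite !gralg_starE invgK conjCK. Qed.

Lemma gralg_starD : {morph (gralg_star : gralg C M -> gralg C M) : x y / x + y}.
Proof.
by move=> x y; apply/malgP => k; rewrite mcoeffD !gralg_starE mcoeffD rmorphD.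
Qed.

Lemma gralg_starZ (a : C) (x : gralg C M) :
  gralg_star (a *: x) = a^* *: (gralg_star x : gralg C M).
Proof.
by apply/malgP => k; rewrite mcoeffZ !gralg_starE mcoeffZ rmorphM.
Qed.

Lemma gralg_starM (x y : gralg C M) :
  gralg_star (x * y) = (gralg_star y : gralg C M) * gralg_star x.
Proof.
have star0 : gralg_star 0 = 0.
  by apply/malgP => k; rewrite gralg_starE !mcoeff0 conjC0.
move: x y; elim/malg_ind => [|x y IHx IHy|c k] z.
- by rewrite mul0r star0 mulr0.
- by rewrite mulrDl !gralg_starD mulrDr IHx IHy.
move: z; elim/malg_ind => [|x y IHx IHy|c2 k2].
- by rewrite mulr0 star0 mul0r.
- by rewrite mulrDr !gralg_starD mulrDl IHx IHy.
by rewrite gralgMUU !gralg_starU gralgMUU invgM rmorphM mulrC.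
Qed.

HB.instance Definition _ := isStarAlgebra.Build C (gralg C M)
  gralg_starK gralg_starD gralg_starZ gralg_starM.

Definition gr_lambda (g : M) : gralg C M := << g >>.

End GroupAlgebra.

Arguments gr_lambda C {M} g.

Section PointwiseGroup.
Context (I : Type) (G : groupType).
Implicit Types a b c : I -> G.

Definition pw_mul a b : I -> G := fun i => (a i * b i)%g.
Definition pw_one : I -> G := fun=> 1%g.
Definition pw_inv a : I -> G := fun i => (a i)^-1%g.

Lemma pw_mulA : associative pw_mul.
Proof. by move=> a b c; apply/funext => i; rewrite /pw_mul mulgA. Qed.
Lemma pw_mul1 : left_id pw_one pw_mul.
Proof. by move=> a; apply/funext => i; rewrite /pw_mul mul1g. Qed.
Lemma pw_mulr1 : right_id pw_one pw_mul.
Proof. by move=> a; apply/funext => i; rewrite /pw_mul mulg1. Qed.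
Lemma pw_mulV : left_inverse pw_one pw_inv pw_mul.
Proof. by move=> a; apply/funext => i; rewrite /pw_mul /pw_inv mulVg. Qed.
Lemma pw_mulrV : right_inverse pw_one pw_inv pw_mul.
Proof. by move=> a; apply/funext => i; rewrite /pw_mul /pw_inv mulgV. Qed.

HB.instance Definition _ := isGroup.Build (I -> G)
  pw_mulA pw_mul1 pw_mulr1 pw_mulV pw_mulrV.

End PointwiseGroup.

Section Circle.
Context (C : numClosedFieldType).

Record circle := Circle { circle_val : C; _ : `|circle_val| == 1 }.

HB.instance Definition _ := [isSub for circle_val].
HB.instance Definition _ := [Choice of circle by <:].

Lemma normr_circle (t : circle) : `|circle_val t| = 1.
Proof. by case: t => t /= /eqP. Qed.

Lemma circle_one_subproof : `|1 : C| == 1. Proof. by rewrite normr1. Qed.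
Lemma circle_mul_subproof (s t : circle) :
  `|circle_val s * circle_val t| == 1.
Proof. by rewrite normrM !normr_circle mulr1. Qed.
Lemma circle_inv_subproof (t : circle) : `|(circle_val t)^-1| == 1.
Proof. by rewrite normfV normr_circle invr1. Qed.

Definition circle_one := Circle circle_one_subproof.
Definition circle_mul s t := Circle (circle_mul_subproof s t).
Definition circle_inv t := Circle (circle_inv_subproof t).

Lemma circle_neq0 (t : circle) : circle_val t != 0.
Proof. by rewrite -normr_eq0 normr_circle oner_eq0. Qed.
Lemma circle_mulA : associative circle_mul.
Proof. by move=> r s t; apply/val_inj; rewrite /= mulrA. Qed.
Lemma circle_mul1 : left_id circle_one circle_mul.
Proof. by move=> t; apply/val_inj; rewrite /= mul1r. Qed.
Lemma circle_mulr1 : right_id circle_one circle_mul.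
Proof. by move=> t; apply/val_inj; rewrite /= mulr1. Qed.
Lemma circle_mulV : left_inverse circle_one circle_inv circle_mul.
Proof. by move=> t; apply/val_inj; rewrite /= mulVf// circle_neq0. Qed.
Lemma circle_mulrV : right_inverse circle_one circle_inv circle_mul.
Proof. by move=> t; apply/val_inj; rewrite /= mulfV// circle_neq0. Qed.

HB.instance Definition _ := isGroup.Build circle
  circle_mulA circle_mul1 circle_mulr1 circle_mulV circle_mulrV.

End Circle.

Coercion circle_val : circle >-> Num.ClosedField.sort.

(* The relation ~ : equality at all but finitely many indices. *)
Definition cofin_eq (I X : Type) (a b : I -> X) : Prop :=
  finite_set [set i | a i <> b i].

Section CofinEq.
Context (I X : Type).
Implicit Types a b c : I -> X.

Lemma cofin_eqxx a : cofin_eq a a.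
Proof. by rewrite /cofin_eq (_ : mkset _ = set0)//; apply/seteqP; split. Qed.

Lemma cofin_eqC a b : cofin_eq a b -> cofin_eq b a.
Proof. by apply: sub_finite_set => i /= /nesym. Qed.

Lemma cofin_eq_trans b a c : cofin_eq a b -> cofin_eq b c -> cofin_eq a c.
Proof.
move=> ab bc; apply: (@sub_finite_set _ _
  ([set i | a i <> b i] `|` [set i | b i <> c i])); last first.
  by rewrite finite_setU.
move=> i /= ac; have [abi|] := pselect (a i = b i); last by left.
by right; rewrite -abi.
Qed.

Lemma cofin_eq_map (Y : Type) (f : X -> Y) a b :
  cofin_eq a b -> cofin_eq (f \o a) (f \o b).
Proof. by apply: sub_finite_set => i /= nf e; apply: nf; rewrite e. Qed.

Lemma cofin_eq_map2 (f : X -> X -> X) a b c d : cofin_eq a b -> cofin_eq c d ->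
  cofin_eq (fun i => f (a i) (c i)) (fun i => f (b i) (d i)).
Proof.
move=> ab cd; apply: (@sub_finite_set _ _
  ([set i | a i <> b i] `|` [set i | c i <> d i])); last first.
  by rewrite finite_setU.
move=> i /= nf; have [abi|] := pselect (a i = b i); last by left.
by right=> cdi; apply: nf; rewrite abi cdi.
Qed.

End CofinEq.

Section Omega.
Context (C : numClosedFieldType) (I : choiceType).
Implicit Types a b : I -> circle C.

Definition omega_rel a b : bool := `[< cofin_eq a b >].

Lemma omega_rel_equiv : equiv_class_of omega_rel.
Proof.
split=> [a|a b|b a c]; first exact/asboolP/cofin_eqxx.
  by apply/asboolP/asboolP; apply: cofin_eqC.
by move=> /asboolP ab /asboolP bc; apply/asboolP/(cofin_eq_trans ab).
Qed.

Canonical omega_equiv := EquivRelPack omega_rel_equiv.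

Definition Omega_ut : Type := {eq_quot omega_equiv}.

HB.instance Definition _ := Choice.on Omega_ut.
HB.instance Definition _ := EqQuotient.on Omega_ut.

Definition omega_class a : Omega_ut := \pi_Omega_ut a.

Lemma omega_classP a b : omega_class a = omega_class b <-> cofin_eq a b.
Proof.
by split=> [/eqmodP/asboolP //|ab]; apply/eqmodP/asboolP.
Qed.

Definition omega_mul (v w : Omega_ut) : Omega_ut :=
  omega_class (repr v * repr w)%g.
Definition omega_inv (w : Omega_ut) : Omega_ut := omega_class (repr w)^-1%g.
Definition omega_one : Omega_ut := omega_class 1%g.

Lemma omega_mulE a b :
  omega_mul (omega_class a) (omega_class b) = omega_class (a * b)%g.
Proof.
apply/omega_classP.
by apply: (@cofin_eq_map2 I _ *%g (repr _) a (repr _) b);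
  apply/omega_classP; exact: reprK.
Qed.

Lemma omega_invE a : omega_inv (omega_class a) = omega_class a^-1%g.
Proof.
apply/omega_classP; apply: (@cofin_eq_map I _ _ (fun t => t^-1)%g (repr _) a).
by apply/omega_classP; exact: reprK.
Qed.

Lemma omega_ind (P : Omega_ut -> Prop) :
  (forall a, P (omega_class a)) -> forall w, P w.
Proof. by move=> h w; rewrite -[w]reprK; apply: h. Qed.

Lemma omega_mulA : associative omega_mul.
Proof.
by elim/omega_ind=> a; elim/omega_ind=> b; elim/omega_ind=> c; rewrite !omega_mulE mulgA.
Qed.
Lemma omega_mul1 : left_id omega_one omega_mul.
Proof. by elim/omega_ind=> a; rewrite omega_mulE mul1g. Qed.
Lemma omega_mulr1 : right_id omega_one omega_mul.
Proof. by elim/omega_ind=> a; rewrite omega_mulE mulg1. Qed.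
Lemma omega_mulV : left_inverse omega_one omega_inv omega_mul.
Proof. by elim/omega_ind=> a; rewrite omega_invE omega_mulE mulVg. Qed.
Lemma omega_mulrV : right_inverse omega_one omega_inv omega_mul.
Proof. by elim/omega_ind=> a; rewrite omega_invE omega_mulE mulgV. Qed.

HB.instance Definition _ := isGroup.Build Omega_ut
  omega_mulA omega_mul1 omega_mulr1 omega_mulV omega_mulrV.

(* For a finitely supported family the fsbigop product is the paper's
   finite product; on other families it is a junk value. *)
Definition extends_prod (phi : {multiplicative (I -> circle C) -> circle C}) :=
  forall a, cofin_eq a 1%g ->
    phi a = \big[*%R/1]_(i \in [set: I]) (a i : C) :> C.

End Omega.

Section TensorPower.
Context (C : numClosedFieldType) (I : choiceType).

Definition multilinear (W : lmodType C) (f : (I -> C) -> W) : Prop :=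
  forall (b : I -> C) (i : I) (a x y : C),
    f (dfwith b i (a * x + y)) =
    a *: f (dfwith b i x) + f (dfwith b i y).

(* Any model of the tensor power, given by its universal property together with
   its *-algebra structure; tensorPower_quot below is one. *)
Structure tensorPower := TensorPower {
  tpow_sort :> comStarAlgType C;
  tens : (I -> C) -> tpow_sort;
  tens_multilinear : multilinear tens;
  tens_universal : forall (W : lmodType C) (f : (I -> C) -> W),
    multilinear f ->
    exists2 g : {linear tpow_sort -> W}, (forall b, g (tens b) = f b) &
      forall h : {linear tpow_sort -> W}, (forall b, h (tens b) = f b) ->
      h =1 g;
  tensM : forall b c, tens b * tens c = tens (fun i => b i * c i);
  tens_star : forall b, star (tens b) = tens (fun i => (b i)^*)
}.

Definition lspan (V : lmodType C) (A : set V) : set V :=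
  [set v | exists n (c : 'I_n -> C) (e : 'I_n -> V),
     (forall j, A (e j)) /\ v = \sum_j c j *: e j].

Context (T : tensorPower).

Definition tens_sector (w : Omega_ut C I) : set T :=
  lspan [set tens T b | b in
    [set b | exists2 a : I -> circle C, omega_class a = w &
             cofin_eq b (fun i => a i : C)]].

(* The span of the union is the internal sum of the sectors; that this sum is
   direct is a consequence of the universal property. *)
Definition ut_set : set T :=
  lspan (\bigcup_(w in [set: Omega_ut C I]) tens_sector w).

Definition ut_pred : {pred T} := fun x => `[< ut_set x >].

End TensorPower.

Arguments tens {C I} t b.
Arguments tens_sector {C I} T w _.
Arguments ut_set {C I} T _.
Arguments ut_pred {C I} T x.

Section LSpan.
Context (C : numClosedFieldType) (V : lmodType C).
Implicit Types (A : set V) (P : V -> Prop).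

Lemma lspan_sub A : A `<=` lspan A.
Proof.
move=> v Av; exists 1%N, (fun=> 1), (fun=> v); split=> //.
by rewrite big_ord1 scale1r.
Qed.

Lemma lspan_ind A P : P 0 -> (forall a x y, P x -> P y -> P (a *: x + y)) ->
  (forall x, A x -> P x) -> lspan A `<=` P.
Proof.
move=> P0 PL PA v [n [c [e [Ae ->]]]].
elim/big_rec: _ => // j y _ Py; apply: PL => //; exact: PA.
Qed.

Lemma lspan0 A : lspan A 0.
Proof.
exists 0%N, (fun=> 0), (fun=> 0); split; first by case.
by rewrite big_ord0.
Qed.

Lemma lspanP A a x y : lspan A x -> lspan A y -> lspan A (a *: x + y).
Proof.
move=> [n [c [e [Ae ->]]]] [m [d [f [Af ->]]]].
exists (n + m)%N,
  (fun j => match fintype.split j with inl k => a * c k | inr k => d k end),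
  (fun j => match fintype.split j with inl k => e k | inr k => f k end).
split=> [j|]; first by case: fintype.split.
rewrite big_split_ord /= scaler_sumr; congr (_ + _); apply: eq_bigr => j _.
  by rewrite (unsplitK (inl j)) scalerA.
by rewrite (unsplitK (inr j)).
Qed.

End LSpan.

Section UtSubalgebra.
Context (C : numClosedFieldType) (I : choiceType) (T : tensorPower C I).

Definition circle_tens (a : I -> circle C) : T := tens T (fun i => a i : C).

Lemma ut_predP x : reflect (ut_set T x) (x \in ut_pred T).
Proof. exact: asboolP. Qed.

Lemma ut_tens b a : cofin_eq b (fun i => circle_val (a i)) -> ut_set T (tens T b).
Proof.
move=> ba; apply: lspan_sub; exists (omega_class a) => //.
by apply: lspan_sub; exists b => //; exists a.
Qed.

Lemma ut_set_ind (P : T -> Prop) :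
  P 0 -> (forall k x y, P x -> P y -> P (k *: x + y)) ->
  (forall b a, cofin_eq b (fun i => circle_val (a i)) -> P (tens T b)) ->
  ut_set T `<=` P.
Proof.
move=> P0 PL PT; apply: lspan_ind => // x [w _]; move: x.
by apply: lspan_ind => // x [b [a _ ba] <-]; exact: PT ba.
Qed.

Lemma tens1 : tens T (fun=> 1) = 1.
Proof.
have [g _ uni] := @tens_universal _ _ T T (tens T) (@tens_multilinear _ _ T).
have lin : linear (fun x : T => tens T (fun=> 1) * x : T).
  by move=> k x y /=; rewrite mulrDr scalerAr.
pose h := HB.pack (fun x : T => tens T (fun=> 1) * x : T)
  (GRing.isLinear.Build C T T *:%R _ lin) : {linear T -> T}.
have hE b : h (tens T b) = tens T b.
  by rewrite /h /= tensM; congr tens; apply/funext => i; rewrite mul1r.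
have e : h =1 (idfun : {linear T -> T}).
  by move=> x; rewrite (uni h hE) (uni idfun).
by have := e 1; rewrite /h /= mulr1.
Qed.

Lemma ut_subalg_closed : GRing.subalg_closed (ut_pred T).
Proof.
split=> [|k x y /ut_predP ux /ut_predP uy|x y /ut_predP ux /ut_predP uy].
- apply/ut_predP; rewrite -tens1; apply: (@ut_tens _ (fun=> circle_one C)).
  exact: cofin_eqxx.
- exact/ut_predP/lspanP.
- apply/ut_predP; move: x ux; apply: ut_set_ind => [|k x x' ux ux'|b a ba].
  + by rewrite mul0r; exact: lspan0.
  + by rewrite mulrDl -scalerAl; exact: lspanP.
  move: y uy; apply: ut_set_ind => [|k y y' uy uy'|b' a' ba'].
  + by rewrite mulr0; exact: lspan0.
  + by rewrite mulrDr -scalerAr; exact: lspanP.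
  rewrite tensM; apply: (@ut_tens _ (fun i => circle_mul (a i) (a' i))) => /=.
  exact: (@cofin_eq_map2 I _ *%R _ _ _ _ ba ba').
Qed.

Lemma star0 (A : starAlgType C) : star (0 : A) = 0.
Proof. by have := starZ 0 (0 : A); rewrite conjC0 !scale0r. Qed.

Lemma circle_conj_subproof (t : circle C) : `|t^*| == 1.
Proof. by rewrite norm_conjC normr_circle. Qed.

Lemma ut_star x : x \in ut_pred T -> star x \in ut_pred T.
Proof.
move=> /ut_predP ux; apply/ut_predP; move: x ux.
apply: ut_set_ind => [|k x y ux uy|b a ba].
- by rewrite star0; exact: lspan0.
- by rewrite starD starZ; exact: lspanP.
rewrite tens_star; apply: (@ut_tens _ (fun i => Circle (circle_conj_subproof (a i)))).
exact: (@cofin_eq_map I _ _ Num.conj _ _ ba).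
Qed.

HB.instance Definition _ := GRing.isSubalgClosed.Build C T (ut_pred T)
  ut_subalg_closed.

Record utpow := UtPow { utpow_val : T; _ : utpow_val \in ut_pred T }.

HB.instance Definition _ := [isSub for utpow_val].
HB.instance Definition _ := [Choice of utpow by <:].
HB.instance Definition _ := [SubChoice_isSubAlgebra of utpow by <:].
HB.instance Definition _ :=
  GRing.SubNzRing_isSubComNzRing.Build T (ut_pred T) utpow.

Lemma utpowP (x : utpow) : utpow_val x \in ut_pred T.
Proof. by case: x. Qed.

Definition utpow_star (x : utpow) : utpow := UtPow (ut_star (utpowP x)).

Lemma utpow_starK : involutive utpow_star.
Proof. by move=> x; apply/val_inj; rewrite /= starK. Qed.
Lemma utpow_starD : {morph utpow_star : x y / x + y}.
Proof. by move=> x y; apply/val_inj; rewrite /= starD. Qed.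
Lemma utpow_starZ (a : C) x : utpow_star (a *: x) = a^* *: utpow_star x.
Proof. by apply/val_inj; rewrite /= starZ. Qed.
Lemma utpow_starM x y : utpow_star (x * y) = utpow_star y * utpow_star x.
Proof. by apply/val_inj; rewrite /= starM. Qed.

HB.instance Definition _ := isStarAlgebra.Build C utpow
  utpow_starK utpow_starD utpow_starZ utpow_starM.

Lemma circle_tens_ut a : circle_tens a \in ut_pred T.
Proof. by apply/ut_predP; apply: ut_tens; exact: cofin_eqxx. Qed.

Definition utens a : utpow := UtPow (circle_tens_ut a).

End UtSubalgebra.

Section Existence.
Context (C : numClosedFieldType) (I : choiceType).

(* The tensor power as the *-algebra of the multiplicative *-monoid of all
   families, modulo the ideal of multilinearity relators. *)
Definition famC : Type := I -> C.
HB.instance Definition _ := Choice.on famC.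

Definition fam_mul (b c : famC) : famC := fun i => b i * c i.
Definition fam_one : famC := fun=> 1.
Definition fam_conj (b : famC) : famC := fun i => (b i)^*.

Lemma fam_mulA : associative fam_mul.
Proof. by move=> a b c; apply/funext => i; rewrite /fam_mul mulrA. Qed.
Lemma fam_mul1 : left_id fam_one fam_mul.
Proof. by move=> a; apply/funext => i; rewrite /fam_mul mul1r. Qed.
Lemma fam_conjK : involutive fam_conj.
Proof. by move=> a; apply/funext => i; rewrite /fam_conj conjCK. Qed.
Lemma fam_conjM : {morph fam_conj : b c / fam_mul b c >-> fam_mul c b}.
Proof.
by move=> a b; apply/funext => i; rewrite /fam_conj /fam_mul rmorphM mulrC.
Qed.

HB.instance Definition _ := isStarMonoid.Build famC
  fam_mulA fam_mul1 fam_conjK fam_conjM.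

Definition freeT : Type := gralg C famC.
HB.instance Definition _ := StarAlgebra.on freeT.

Implicit Types (x y : freeT) (b : famC).

Lemma freeT_mulC : @commutative freeT freeT *%R.
Proof.
elim/malg_ind => [|x y IHx IHy|c k] z; first by rewrite mul0r mulr0.
  by rewrite mulrDl mulrDr IHx IHy.
move: z; elim/malg_ind => [|x y IHx IHy|c2 k2]; first by rewrite mul0r mulr0.
  by rewrite mulrDl mulrDr IHx IHy.
rewrite /GRing.mul /= !gralg_mulUU mulrC; congr mkmalgU.
by apply/funext => i; exact: mulrC.
Qed.
HB.instance Definition _ := GRing.PzRing_hasCommutativeMul.Build freeT freeT_mulC.

Definition delta b : freeT := << b >>.

Definition relator : set freeT := [set r | exists b i (a x y : C),
  r = delta (dfwith b i (a * x + y)) -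
      (a *: delta (dfwith b i x) + delta (dfwith b i y))].

Definition rel_ideal : {pred freeT} := fun x => `[< lspan relator x >].

Lemma rel_idealP x : reflect (lspan relator x) (x \in rel_ideal).
Proof. exact: asboolP. Qed.

Section FreeLift.
Context (W : lmodType C) (f : (I -> C) -> W).

Definition free_lift x : W := \sum_(k <- msupp x) x@_k *: f k.

Lemma free_liftw (d : {fset famC}) x : (msupp x `<=` d)%fset ->
  free_lift x = \sum_(k <- d) x@_k *: f k.
Proof.
move=> xd; rewrite /free_lift (big_fset_incl _ xd) //= => k _ /mcoeff_outdom ->.
by rewrite scale0r.
Qed.

Lemma free_lift_linear : linear free_lift.
Proof.
move=> a x y; pose d := (msupp x `|` msupp y)%fset.
have xd : (msupp x `<=` d)%fset := fsubsetUl _ _.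
have yd : (msupp y `<=` d)%fset := fsubsetUr _ _.
rewrite (free_liftw xd) (free_liftw yd) (@free_liftw d); last first.
  apply: fsubset_trans (msuppD_le _ _) _; rewrite fsubUset yd andbT.
  exact: fsubset_trans (msuppZ_le _ _) xd.
rewrite scaler_sumr -big_split; apply: eq_bigr => k _ /=.
by rewrite mcoeffD mcoeffZ scalerDl scalerA.
Qed.

HB.instance Definition _ := GRing.isLinear.Build C freeT W *:%R free_lift
  free_lift_linear.

Lemma free_lift_delta b : free_lift (delta b) = f b.
Proof.
by rewrite (@free_liftw [fset b]%fset) ?msuppU_le// big_seq_fset1 mcoeffUU scale1r.
Qed.

Lemma free_lift_ideal x : multilinear f -> x \in rel_ideal -> free_lift x = 0.
Proof.
move=> mf /rel_idealP; move: x.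
apply: lspan_ind => [|a x y x0 y0|_ [b [i [a [x [y ->]]]]]].
- exact: linear0.
- by rewrite linearP /= x0 y0 scaler0 addr0.
by rewrite linearB linearP /= !free_lift_delta mf subrr.
Qed.

End FreeLift.

(* A multilinear form that does not vanish at the constant family 1: it shows
   that the ideal of relators is proper. *)
Definition finprod (b : I -> C) : C^o :=
  if `[< cofin_eq b (fun=> 1) >] then \big[*%R/1]_(i \in [set: I]) b i else 0.

Lemma cofin_eq_dfwith (b : I -> C) i (x : C) : cofin_eq (dfwith b i x) b.
Proof.
apply: sub_finite_set (finite_set1 i) => j /=.
by case: dfwithP => // k _ /[!eqxx].
Qed.

Lemma multilinear_finprod : multilinear finprod.
Proof.
move=> b i a x y; rewrite /finprod.
have e z : `[< cofin_eq (dfwith b i z) (fun=> 1) >] = `[< cofin_eq b (fun=> 1) >].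
  apply/asboolP/asboolP; last exact/cofin_eq_trans/cofin_eq_dfwith.
  exact/cofin_eq_trans/cofin_eqC/cofin_eq_dfwith.
rewrite !e; case: asboolP => [bfin|_]; last by rewrite scaler0 addr0.
pose D := [set j | b j <> 1] `|` [set i].
have finD : finite_set D by rewrite finite_setU.
have Di : D i by right.
have prodE z : \big[*%R/1]_(j \in [set: I]) dfwith b i z j =
    z * \big[*%R/1]_(j \in D `\ i) b j.
  rewrite -(fsbig_widen D setT) //; last first.
    move=> j [_ /= /not_orP[/contrapT bj ji]].
    by rewrite dfwithout// eq_sym; apply/eqP.
  rewrite (fsbigD1 i D _ finD Di).
  rewrite dfwithin; congr (_ * _); apply: eq_fsbigr => j /[!inE] -[_ /= ji].
  by rewrite dfwithout// eq_sym; apply/eqP.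
by rewrite !prodE mulrDl -mulrA.
Qed.

Lemma delta_mul b c : delta b * delta c = delta (b * c)%g.
Proof. by rewrite /GRing.mul /= gralg_mulUU mulr1. Qed.

Lemma malgU_delta (c : C) b : << c *g b >> = c *: delta b :> freeT.
Proof. by rewrite malgZU mulr1. Qed.

Lemma fam_mul_dfwith b c i (x : C) :
  (b * dfwith c i x)%g = dfwith (b * c)%g i (b i * x) :> famC.
Proof.
apply/funext => j.
change (b j * dfwith c i x j = dfwith (fam_mul b c) i (b i * x) j).
by have [<-|ij] := eqVneq i j; [rewrite !dfwithin|rewrite !dfwithout].
Qed.

Lemma rel_ideal_closed : idealr_closed rel_ideal.
Proof.
split.
- exact/rel_idealP/lspan0.
- apply/negP => /(free_lift_ideal multilinear_finprod).
  rewrite (_ : 1 = delta fam_one) // free_lift_delta /finprod.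
  case: asboolP => [_|]; last by move=> /(_ (cofin_eqxx _)).
  by rewrite fsbig1// => /eqP; rewrite oner_eq0.
move=> a x y /rel_idealP ux /rel_idealP uy; apply/rel_idealP.
rewrite -[a * x]scale1r; apply: lspanP => //.
move: x ux; apply: lspan_ind => [|k x x' ux ux'|_ [b [i [k [x [x' ->]]]]]].
- by rewrite mulr0; exact: lspan0.
- by rewrite mulrDr -scalerAr; exact: lspanP.
move: a; elim/malg_ind => [|a a' ua ua'|c d]; first by rewrite mul0r; exact: lspan0.
  by rewrite mulrDl -[X in X + _]scale1r; exact: lspanP.
rewrite malgU_delta -scalerAl -[X in lspan _ X]addr0; apply: lspanP; last exact: lspan0.
apply: lspan_sub; exists (d * b)%g, i, k, (d i * x), (d i * x').
rewrite mulrBr mulrDr -scalerAr !delta_mul !fam_mul_dfwith.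
by rewrite [d i * (_ + _)]mulrDr [d i * (k * x)]mulrCA.
Qed.

HB.instance Definition _ := isIdealr.Build freeT rel_ideal rel_ideal_closed.

Lemma rel_ideal_star x : x \in rel_ideal -> star x \in rel_ideal.
Proof.
move=> /rel_idealP ux; apply/rel_idealP; move: x ux.
have star_delta b : star (delta b) = delta (b^-1)%g :> freeT.
  by rewrite [LHS]gralg_starU conjC1.
have starN (r : freeT) : star (- r) = - star r.
  by rewrite -scaleN1r starZ rmorphN rmorph1 scaleN1r.
have conj_dfwith b i (x : C) :
    (dfwith b i x : famC)^-1%g = dfwith (b^-1)%g i x^* :> famC.
  apply/funext => j.
  change ((dfwith b i x j)^* = dfwith (fam_conj b) i x^* j).
  by have [<-|ij] := eqVneq i j; [rewrite !dfwithin|rewrite !dfwithout].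
apply: lspan_ind => [|k x x' ux ux'|_ [b [i [k [x [x' ->]]]]]].
- by rewrite star0; exact: lspan0.
- by rewrite starD starZ; exact: lspanP.
apply: lspan_sub; exists (b^-1)%g, i, k^*, x^*, x'^*.
rewrite starD starN starD starZ.
by rewrite !star_delta !conj_dfwith rmorphD rmorphM.
Qed.

Definition quotT : Type := {ideal_quot rel_ideal}.
HB.instance Definition _ := GRing.ComNzRing.on quotT.
HB.instance Definition _ := EqQuotient.on quotT.

Definition piT (x : freeT) : quotT := \pi_({ideal_quot rel_ideal}) x.

Lemma piT_repr (q : quotT) : piT (repr q) = q.
Proof. exact: reprK. Qed.

Lemma piTD : {morph piT : x y / x + y}.
Proof. exact: (rmorphD \pi_({ideal_quot rel_ideal})). Qed.

Lemma piTM : {morph piT : x y / x * y}.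
Proof. exact: (rmorphM \pi_({ideal_quot rel_ideal})). Qed.

Lemma piT1 : piT 1 = 1.
Proof. exact: (rmorph1 \pi_({ideal_quot rel_ideal})). Qed.

Lemma piT_eq x y : piT x = piT y <-> x - y \in rel_ideal.
Proof. by rewrite Quotient.idealrBE; split=> [/eqP|/eqP]. Qed.

Definition quotT_scale (a : C) (q : quotT) : quotT := piT (a *: 1) * q.

Lemma quotT_scaleA (a b : C) (q : quotT) :
  quotT_scale a (quotT_scale b q) = quotT_scale (a * b) q.
Proof. by rewrite /quotT_scale mulrA -piTM -scalerAl mul1r scalerA. Qed.
Lemma quotT_scale1 : left_id 1 quotT_scale.
Proof. by move=> q; rewrite /quotT_scale scale1r piT1 mul1r. Qed.
Lemma quotT_scaleDr : right_distributive quotT_scale +%R.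
Proof. by move=> a q r; rewrite /quotT_scale mulrDr. Qed.
Lemma quotT_scaleDl q : {morph quotT_scale^~ q : a b / a + b}.
Proof. by move=> a b; rewrite /quotT_scale scalerDl piTD mulrDl. Qed.

HB.instance Definition _ := GRing.Zmodule_isLmodule.Build C quotT
  quotT_scaleA quotT_scale1 quotT_scaleDr quotT_scaleDl.

Lemma quotT_scaleAl (a : C) (q r : quotT) : a *: (q * r) = (a *: q) * r.
Proof. exact: mulrA. Qed.
HB.instance Definition _ := GRing.Lmodule_isLalgebra.Build C quotT quotT_scaleAl.
HB.instance Definition _ := GRing.Lalgebra_isComAlgebra.Build C quotT.

Lemma piTZ (a : C) x : piT (a *: x) = a *: piT x.
Proof. by rewrite -[x in LHS]mul1r scalerAl piTM. Qed.

Definition quotT_star (q : quotT) : quotT := piT (star (repr q : freeT)).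

Lemma quotT_starE x : quotT_star (piT x) = piT (star x).
Proof.
apply/piT_eq; set y : freeT := repr _.
have : y - x \in rel_ideal by apply/piT_eq; exact: piT_repr.
move=> /rel_ideal_star; rewrite starD -[in star (- x)]scaleN1r starZ.
by rewrite rmorphN rmorph1 scaleN1r.
Qed.

Lemma quotT_ind (P : quotT -> Prop) : (forall x, P (piT x)) -> forall q, P q.
Proof. by move=> h q; rewrite -[q]piT_repr. Qed.

Lemma quotT_starK : involutive quotT_star.
Proof. by elim/quotT_ind => x; rewrite !quotT_starE starK. Qed.
Lemma quotT_starD : {morph quotT_star : x y / x + y}.
Proof.
elim/quotT_ind => x; elim/quotT_ind => y.
by rewrite -piTD !quotT_starE starD piTD.
Qed.
Lemma quotT_starZ (a : C) (q : quotT) : quotT_star (a *: q) = a^* *: quotT_star q.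
Proof. by elim/quotT_ind: q => x; rewrite -piTZ !quotT_starE starZ piTZ. Qed.
Lemma quotT_starM (x y : quotT) : quotT_star (x * y) = quotT_star y * quotT_star x.
Proof.
elim/quotT_ind: x => x; elim/quotT_ind: y => y.
by rewrite -piTM !quotT_starE starM piTM.
Qed.

HB.instance Definition _ := isStarAlgebra.Build C quotT
  quotT_starK quotT_starD quotT_starZ quotT_starM.

Definition quot_tens (b : I -> C) : quotT := piT (delta b).

Lemma quot_tens_multilinear : multilinear quot_tens.
Proof.
move=> b i a x y; rewrite /quot_tens -piTZ -piTD; apply/piT_eq/rel_idealP.
by apply: lspan_sub; exists b, i, a, x, y.
Qed.

Lemma quot_tens_universal (W : lmodType C) (f : (I -> C) -> W) :
  multilinear f ->
  exists2 g : {linear quotT -> W}, (forall b, g (quot_tens b) = f b) &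
    forall h : {linear quotT -> W}, (forall b, h (quot_tens b) = f b) ->
    h =1 g.
Proof.
move=> mf; pose gf (q : quotT) : W := free_lift f (repr q : freeT).
have gfE x : gf (piT x) = free_lift f x.
  apply/eqP; rewrite -subr_eq0 -linearB; apply/eqP/free_lift_ideal => //.
  by apply/piT_eq; exact: piT_repr.
have glin : linear gf.
  move=> a; elim/quotT_ind => x; elim/quotT_ind => y.
  by rewrite -piTZ -piTD !gfE linearP.
pose g := HB.pack gf (GRing.isLinear.Build C quotT W *:%R gf glin)
  : {linear quotT -> W}.
exists g => [b|h hE]; first by rewrite /g /= gfE free_lift_delta.
elim/quotT_ind; rewrite /g /= => x; rewrite gfE; move: x.
elim/malg_ind => [|x y IHx IHy|c k].
- have -> : piT 0 = 0 by rewrite -(scale0r (0 : freeT)) piTZ scale0r.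
  by rewrite !linear0.
- by rewrite piTD !linearD /= IHx IHy.
by rewrite malgU_delta piTZ !linearZ /= free_lift_delta hE.
Qed.

Lemma quot_tensM b c : quot_tens b * quot_tens c = quot_tens (fun i => b i * c i).
Proof. by rewrite /quot_tens -piTM delta_mul. Qed.

Lemma quot_tens_star b : star (quot_tens b) = quot_tens (fun i => (b i)^*).
Proof.
rewrite [LHS]quotT_starE; congr piT.
by rewrite [LHS]gralg_starU conjC1.
Qed.

Definition tensorPower_quot : tensorPower C I :=
  TensorPower quot_tens_multilinear quot_tens_universal quot_tensM quot_tens_star.

End Existence.

(* Main.v *)
(* A character phi extending the product of finitely supported families exists
   because the circle is divisible, hence injective among abelian groups.

   If b agrees with a family a of nonzero numbers outside a finite set, then
   multilinearity gives tens b = (prod_i b_i / a_i) tens a, so each sector is a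
   line, spanned by tens a for any unitary a in its class. On unitary families
   a ~ b the scalar is phi a / phi b, so phi(a)^-1 tens a depends only on the
   class of a; Phi sends this vector to lambda [a]. To define Phi from the
   universal property, choose a unitary r in each class and send b ~ r to
   (prod_i b_i / r_i) phi(r) lambda [r], and b to 0 if it is in no sector. *)
From HB Require Import structures.
Require Import Defs.
From mathcomp Require Import all_boot all_order all_algebra finmap.
From mathcomp Require Import all_classical reals complex.
From mathcomp Require monalg.

Set Implicit Arguments.
Unset Strict Implicit.
Unset Printing Implicit Defensive.

Import GRing.Theory Num.Theory.

Local Open Scope classical_set_scope.
Local Open Scope ring_scope.

(** * Group homomorphisms and their extension into divisible abelian groups *)

Lemma multiplicative1 (G H : groupType) (f : {multiplicative G -> H}) :
  (f 1 = 1)%g.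
Proof. by apply: (mulgI (f 1%g)); rewrite -gmulfM !mulg1. Qed.

Lemma multiplicativeV (G H : groupType) (f : {multiplicative G -> H}) x :
  (f x^-1 = (f x)^-1)%g.
Proof. by apply: (mulgI (f x)); rewrite -gmulfM !mulgV multiplicative1. Qed.

Section DivisibleExtension.
Context (G H : groupType).
Implicit Types (S : set (G * H)) (u v : G * H).
Local Open Scope group_scope.

(** The graph of a homomorphism from a subgroup of [G] to [H]; for a subgroup of [G * H], triviality
    over 1 amounts to single-valuedness. Encoded as sets, such graphs are ordered by inclusion and
    stable under unions of nonempty chains, as Zorn's lemma requires. *)
Definition partial_hom S : Prop :=
  [/\ S 1, (forall u v, S u -> S v -> S (u / v)) & forall y, S (1, y) -> y = 1].

Lemma partial_homV S u : partial_hom S -> S u -> S u^-1.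
Proof. by case=> S1 SF _ Su; rewrite -div1g; exact: SF. Qed.

Lemma partial_homM S u v : partial_hom S -> S u -> S v -> S (u * v).
Proof.
move=> hS Su Sv; rewrite -[v]invgK; case: (hS) => _ SF _.
by apply: SF => //; exact: partial_homV.
Qed.

Lemma partial_homX S u n : partial_hom S -> S u -> S (u ^+ n).
Proof.
move=> hS Su; elim: n => [|n IH]; first by case: hS.
by rewrite expgS; exact: partial_homM.
Qed.

Lemma pair_expg (x : G) (y : H) n : (x, y) ^+ n = (x ^+ n, y ^+ n).
Proof. by elim: n => // n IH; rewrite !expgS IH. Qed.

Hypothesis commG : forall x y : G, commute x y.
Hypothesis commH : forall x y : H, commute x y.
Hypothesis divH : forall n (y : H), exists z, z ^+ n.+1 = y.

(* The order of x modulo the domain of S decides the choice: if it is n > 0,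
   an n-th root of the value at x ^+ n; if it is infinite, anything. *)
Lemma partial_hom_value S x : partial_hom S ->
  exists h, forall k z, S (x ^+ k, z) -> z = h ^+ k.
Proof.
move=> hS; pose P n := `[< exists z, S (x ^+ n.+1, z) >].
have [exP|nP] := pselect (exists n, P n); last first.
  exists 1 => -[|k] z Sz; first by case: hS => _ _; apply.
  by case: nP; exists k; apply/asboolP; exists z.
case: (ex_minnP exP) => n /asboolP[z0 Sz0] nmin.
have [h hn] := divH n z0; exists h => k z Sz.
have Sh q : S (x ^+ (n.+1 * q), h ^+ (n.+1 * q)).
  by rewrite !expgnA hn -pair_expg; exact: partial_homX.
(* Dividing off a power of [x ^+ n.+1] leaves the exponent [k %% n.+1]. A remainder [r.+1] would
   give [P r] with [r < n], against minimality; for remainder 0 the quotient of values lies over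
   1. *)
have : S (x ^+ (k %% n.+1)%N, z / h ^+ (n.+1 * (k %/ n.+1))).
  have -> : x ^+ (k %% n.+1)%N = x ^+ k / x ^+ (n.+1 * (k %/ n.+1)).
    by rewrite {2}(divn_eq k n.+1) addnC mulnC expgnDr mulgK.
  by case: hS => _ SF _; exact: (SF _ _ Sz (Sh _)).
case E: (k %% n.+1)%N => [|r] Sr.
  rewrite (divn_eq k n.+1) E addn0 mulnC.
  by case: hS => _ _ /(_ _ Sr) /divg1_eq.
have /nmin : P r by apply/asboolP; eexists; exact: Sr.
by rewrite leqNgt; have := ltn_pmod k (ltn0Sn n); rewrite E ltnS => ->.
Qed.

(** The new graph is generated by [S] and [(x, h)]; the choice of [h] keeps the fibre over 1
    trivial. *)
Lemma partial_hom_extend S x : partial_hom S ->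
  exists S' h, [/\ partial_hom S', S `<=` S' & S' (x, h)].
Proof.
move=> hS; have [h hP] := partial_hom_value x hS.
pose t : G * H := (x, h).
have commGH u v : commute u v by congr pair; [exact: commG|exact: commH].
have divMM a b c d : (a * b) / (c * d) = (a / c) * (b / d) :> G * H.
  by rewrite invgM -!mulgA; congr (_ * _); rewrite mulgA [RHS]commGH.
have Sy1 m n y : (n <= m)%N -> S (t ^+ m / t ^+ n * (1, y)) -> y = 1.
  move=> nm; rewrite -expgnFr// pair_expg.
  have -> : (x ^+ (m - n), h ^+ (m - n)) * (1, y)
      = (x ^+ (m - n), h ^+ (m - n) * y) by congr pair; rewrite mulg1.
  by move=> /hP /(canRL (mulKg _)); rewrite mulVg.
(* The quotients [t ^+ m / t ^+ n] run through all integer powers of [t]. *)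
exists [set p | exists m n, S (t ^+ m / t ^+ n * p)], h; split.
- split=> [|p q [m [n Sp]] [m' [n' Sq]]|y [m [n Sy]]].
  + by exists 0%N, 0%N; rewrite mulgV mulg1; case: hS.
  + exists (m + n')%N, (n + m')%N; case: hS => _ /(_ _ _ Sp Sq) + _.
    by rewrite divMM invgF -divMM -!expgnDr.
  + have [nm|/ltnW mn] := leqP n m; first exact: Sy1 Sy.
    (* For [m < n], inversion swaps the two exponents and turns [y] into its inverse. *)
    have /(Sy1 _ _ _ mn) /eqP : S (t ^+ n / t ^+ m * (1, y^-1)).
      have := partial_homV hS Sy; rewrite -[(_ * _)^-1]div1g -[X in X / _]mulg1.
      by rewrite divMM div1g invgF; congr (S (_ * (_, _))); rewrite div1g ?invg1.
    by rewrite invg_eq1 => /eqP.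
- by move=> u Su; exists 0%N, 0%N; rewrite mulgV mul1g.
- by exists 0%N, 1%N; rewrite div1g mulVg; case: hS.
Qed.

Lemma divisible_extension S0 : partial_hom S0 ->
  exists phi : {multiplicative G -> H}, forall u, S0 u -> phi u.1 = u.2.
Proof.
move=> hS0; pose P := [set S | S = set0 \/ partial_hom S /\ S0 `<=` S].
have [F FP Ftot|S [[S_0|[hS S0S]] Smax]] := @Zorn_bigcup _ P.
- have [[S FS [u Su]]|F0] := pselect (exists2 S, F S & S !=set0); last first.
    left; rewrite -subset0 => u [S FS Su]; apply: F0; exists S => //.
    by exists u.
  have good S' v : F S' -> S' v -> partial_hom S' /\ S0 `<=` S'.
    by move=> /FP [-> //|].
  right; split=> [|v S0v]; last by exists S => //; exact: (good _ _ FS Su).2.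
  split=> [|v w [S1 FS1 S1v] [S2 FS2 S2w]|y [S1 FS1 S1y]].
  + by exists S => //; case: (good _ _ FS Su) => -[].
  + have [S12|S21] := Ftot _ _ FS1 FS2.
    * exists S2 => //; have [[_ SF _] _] := good _ _ FS2 S2w.
      by apply: SF => //; exact: S12.
    * exists S1 => //; have [[_ SF _] _] := good _ _ FS1 S1v.
      by apply: SF => //; exact: S21.
  + by have [[_ _ +] _] := good _ _ FS1 S1y; apply.
- case: (Smax S0); last by right; split.
  by rewrite S_0; split=> // S00; case: hS0 => S01 _ _; exact: (S00 1).
(* A maximal graph is total, since otherwise [partial_hom_extend] would enlarge it. *)
have dom x : exists h, S (x, h).
  have [S' [h [hS' SS' S'xh]]] := partial_hom_extend x hS.
  exists h; apply: contrapT => nS; apply: (Smax S').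
    by split=> // /(_ _ S'xh).
  by right; split=> //; exact: subset_trans SS'.
have [f fP] := choice dom.
have fun_S x y z : S (x, y) -> S (x, z) -> y = z.
  move=> Sy Sz; case: hS => _ /(_ _ _ Sy Sz) + S1.
  rewrite [_ / _](_ : _ = (1, y / z)).
    by move=> /S1 /divg1_eq.
  by congr pair; rewrite mulgV.
have fM : {morph f : x y / x * y}.
  move=> x y; apply: (fun_S (x * y)); first exact: fP.
  exact: (partial_homM hS (fP x) (fP y)).
pose phi := HB.pack f (isMultiplicative.Build G H f fM)
  : {multiplicative G -> H}.
exists phi => -[x y] S0xy; exact: (fun_S x _ _ (fP x) (S0S _ S0xy)).
Qed.

End DivisibleExtension.

(** * Finite products, multilinear maps on families equal off a finite set, and existence of
    [phi] *)

Section CofiniteProducts.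
Context (C : numClosedFieldType) (I : choiceType).
Implicit Types (b c : I -> C) (a : I -> circle C).

Lemma cofin_eq_fset (X : Type) (b c : I -> X) : cofin_eq b c ->
  exists s : {fset I}, forall i, i \notin s -> b i = c i.
Proof.
move=> bc; exists (fset_set [set i | b i <> c i]) => i.
by rewrite in_fset_set// notin_setE /= => /contrapT.
Qed.

Lemma finprodE b : cofin_eq b (fun=> 1) ->
  finprod b = \big[*%R/1]_(i \in [set: I]) b i.
Proof. by rewrite /finprod; case: asboolP. Qed.

Lemma finprod_fset b (s : {fset I}) : (forall i, i \notin s -> b i = 1) ->
  finprod b = \prod_(i <- s) b i.
Proof.
move=> bs; rewrite finprodE; first exact: fsbigTE.
by apply: sub_finite_set (finite_fset s) => i bi; apply: contrapT => /negP/bs.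
Qed.

Lemma finprod1 : finprod (fun _ : I => 1 : C) = 1.
Proof. by rewrite (@finprod_fset _ fset0)// big_seq_fset0. Qed.

Lemma finprodM b c : cofin_eq b (fun=> 1) -> cofin_eq c (fun=> 1) ->
  finprod (fun i => b i * c i) = finprod b * finprod c.
Proof.
move=> /cofin_eq_fset[s bs] /cofin_eq_fset[s' cs].
have sub (d : I -> C) (t : {fset I}) : (forall i, i \notin t -> d i = 1) ->
    (t `<=` s `|` s')%fset -> forall i, i \notin (s `|` s')%fset -> d i = 1.
  by move=> dt /fsubsetP tss i iss; apply: dt; apply: contra iss; exact: tss.
have bss := sub b s bs (fsubsetUl _ _); have css := sub c s' cs (fsubsetUr _ _).
rewrite (finprod_fset bss) (finprod_fset css) -big_split /=.
by apply: finprod_fset => i iss; rewrite bss// css// mulr1.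
Qed.

Lemma normr_finprod a : cofin_eq a 1%g -> `|finprod (fun i => a i : C)| = 1.
Proof.
move=> /cofin_eq_fset[s as1]; rewrite (@finprod_fset _ s); last first.
  by move=> i /as1 ->.
by rewrite normr_prod big1// => i _; exact: normr_circle.
Qed.

Lemma multilinear0 (W : lmodType C) (f : (I -> C) -> W) b i :
  multilinear f -> f (dfwith b i 0) = 0.
Proof.
move=> mf; have := mf b i 1 0 0.
by rewrite mulr0 addr0 scale1r => /eqP; rewrite addrC -subr_eq subrr => /eqP.
Qed.

(** The entries of [b] are replaced by those of [c] one index at a time, each replacement
    contributing a factor [b i / c i]. *)
Lemma multilinear_cofin (W : lmodType C) (f : (I -> C) -> W) b c :
  multilinear f -> (forall i, c i != 0) -> cofin_eq b c ->
  f b = finprod (fun i => b i / c i) *: f c.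
Proof.
move=> mf c0 /cofin_eq_fset[s bs]; rewrite (@finprod_fset _ s); last first.
  by move=> i /bs ->; rewrite mulfV.
have {}bs i : i \notin enum_fset s -> b i = c i := bs i.
move: bs (fset_uniq s); elim: (enum_fset s) b => [|i t IH] b bs /=.
  by move=> _; rewrite big_nil scale1r; congr f; apply/funext => i; exact: bs.
move=> /andP[it ut]; rewrite big_cons.
(* Linearity in slot [i] is applied to [(b i / c i) * c i + 0]; the term at 0 vanishes by
   [multilinear0]. *)
have -> : f b = (b i / c i) *: f (dfwith b i (c i)).
  rewrite -[RHS]addr0 -(multilinear0 b i mf) -mf addr0 divfK//.
  by congr f; apply/funext => j; case: dfwithP.
rewrite (IH _ _ ut) => [|j jt]; last first.
  have [<-|ij] := eqVneq i j; first by rewrite dfwithin.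
  by rewrite dfwithout// bs// in_cons negb_or eq_sym ij.
(* The list has no duplicates, so the change at [i] leaves the remaining factors intact. *)
rewrite scalerA; congr (_ * _ *: _); apply: eq_big_seq => j jt.
rewrite dfwithout//.
by apply: contraNneq it => ->.
Qed.

Lemma circle_root n (t : circle C) : exists z : circle C, (z ^+ n.+1)%g = t.
Proof.
have [z zt] : exists z : C, z ^+ n.+1 = circle_val t.
  by exists (n.+1.-root (circle_val t)); rewrite rootCK.
have nz : `|z| == 1.
  by rewrite -(@pexpr_eq1 _ _ n.+1)// -normrX zt normr_circle.
exists (Circle nz); apply/val_inj; rewrite -[RHS]zt.
by elim: {+}n.+1 => // m IH; rewrite expgS exprS /= -IH.
Qed.

Lemma circle_commute (s t : circle C) : commute s t.
Proof. by apply/val_inj; exact: mulrC. Qed.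

Lemma cofin_eq_circle a : cofin_eq a 1%g -> cofin_eq (fun i => a i : C) (fun=> 1).
Proof. exact: (@cofin_eq_map _ _ _ (@circle_val C) a 1%g). Qed.

Lemma extends_prod_exists :
  exists phi : {multiplicative (I -> circle C) -> circle C}, extends_prod phi.
Proof.
pose S :=
  [set u : (I -> circle C) * circle C |
    cofin_eq u.1 1%g /\ finprod (fun i => u.1 i : C) = u.2 :> C].
have commI (x y : I -> circle C) : commute x y.
  by apply/funext => i; exact: circle_commute.
have [|phi phiS] :=
    @divisible_extension _ _ commI circle_commute circle_root S.
- split=> [|u v [u1 fu] [v1 fv]|y [_ /= fy]].
  + by split=> [|/=]; [exact: cofin_eqxx|exact: finprod1].
  + have uv1 : cofin_eq (u / v).1%g 1%g.
      have := cofin_eq_map2 (fun s t => s / t)%g u1 v1.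
      rewrite (_ : (fun i => 1%g i / 1%g i)%g = 1%g)//.
      by apply/funext => i; exact: mulgV.
    (* Multiplying by [v.2] clears the denominators and leaves only multiplicativity of
       [finprod]. *)
    split=> //; apply: (mulIf (circle_neq0 v.2)).
    rewrite -[in LHS]fv -finprodM; [|exact: cofin_eq_circle..].
    rewrite /= mulfVK ?circle_neq0// -fu; congr finprod; apply/funext => i.
    by rewrite /= mulfVK// circle_neq0.
  + by apply/val_inj; rewrite /= -fy; exact: finprod1.
exists phi => a a1; rewrite -finprodE; last exact: cofin_eq_circle.
have /eqP nt := normr_finprod a1.
by rewrite (phiS (a, Circle nt)).
Qed.

End CofiniteProducts.

(** * Linear maps on the group algebra, determined by their values on the basis *)

Section LinearCombinations.
Import monalg.
Context (C : numClosedFieldType) (M : starMonoidType) (W : lmodType C).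
Variable f : M -> W.

Definition gralg_lift (x : gralg C M) : W := \sum_(k <- msupp x) x@_k *: f k.

Lemma gralg_liftw (d : {fset M}) (x : gralg C M) : (msupp x `<=` d)%fset ->
  gralg_lift x = \sum_(k <- d) x@_k *: f k.
Proof.
move=> xd; rewrite /gralg_lift (big_fset_incl _ xd) //= => k _ /mcoeff_outdom ->.
by rewrite scale0r.
Qed.

Lemma gralg_lift_linear : linear gralg_lift.
Proof.
move=> a x y; pose d := (msupp x `|` msupp y)%fset.
have xd : (msupp x `<=` d)%fset := fsubsetUl _ _.
have yd : (msupp y `<=` d)%fset := fsubsetUr _ _.
rewrite (gralg_liftw xd) (gralg_liftw yd) (@gralg_liftw d); last first.
  apply: fsubset_trans (msuppD_le _ _) _; rewrite fsubUset yd andbT.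
  exact: fsubset_trans (msuppZ_le _ _) xd.
rewrite scaler_sumr -big_split; apply: eq_bigr => k _ /=.
by rewrite mcoeffD mcoeffZ scalerDl scalerA.
Qed.

HB.instance Definition _ :=
  GRing.isLinear.Build C (gralg C M) W *:%R gralg_lift gralg_lift_linear.

Lemma gralg_lift_lambda k : gralg_lift (gr_lambda C k) = f k.
Proof.
by rewrite (@gralg_liftw [fset k]%fset) ?msuppU_le// big_seq_fset1 mcoeffUU scale1r.
Qed.

Lemma gralg_linear_ext (g h : {linear gralg C M -> W}) :
  (forall k, g (gr_lambda C k) = h (gr_lambda C k)) -> g =1 h.
Proof.
move=> gh; elim/malg_ind => [|x y gx gy|c k]; first by rewrite !linear0.
  by rewrite !linearD gx gy.
by rewrite -[c]mulr1 -malgZU !linearZ /= gh.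
Qed.

End LinearCombinations.

(** * The unitary part of the tensor power and its isomorphism with the group algebra *)

Section UnitaryPower.
Context (C : numClosedFieldType) (I : choiceType) (T : tensorPower C I).
Local Notation circles := (I -> circle C).
Local Notation Omega := (Omega_ut C I).
Implicit Types (a b : circles).

(** By [multilinear_cofin] every generator of a sector is a multiple of a unitary tensor. No case
    for 0 is required, as 0 is [-1 *: u + u]. *)
Lemma utens_linear_ind (P : utpow T -> Prop) :
  (forall k x y, P x -> P y -> P (k *: x + y)) -> (forall a, P (utens T a)) ->
  forall x, P x.
Proof.
move=> PL Pt.
have P0 : P 0 by rewrite -(addNr (utens T 1%g)) -scaleN1r; exact: PL.
suff H y : ut_set T y -> forall x, utpow_val x = y -> P x.
  by move=> x; apply: H erefl; apply/ut_predP; exact: utpowP.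
(* Membership is carried through the induction so that the summands can be repackaged as elements of
   [utpow T]. *)
move=> uy; have [] : ut_set T y /\ forall x, utpow_val x = y -> P x; last by [].
move: y uy; apply: ut_set_ind => [|k x y [ux Px] [uy Py]|c a ca].
- by split=> [|x x0]; [exact: lspan0|rewrite (_ : x = 0)//; exact/val_inj].
- split=> [|z zE]; first exact: lspanP.
  pose x' : utpow T := UtPow (introT (ut_predP x) ux).
  pose y' : utpow T := UtPow (introT (ut_predP y) uy).
  rewrite (_ : z = k *: x' + y'); last exact/val_inj.
  by apply: PL; [exact: Px|exact: Py].
- split=> [|x xE]; first exact: ut_tens ca.
  rewrite (_ : x = finprod (fun i => c i / (a i : C)) *: utens T a + 0).
    exact: PL.
  apply/val_inj; rewrite /= addr0 xE; apply: multilinear_cofin ca.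
    exact: tens_multilinear.
  by move=> i; exact: circle_neq0.
Qed.

Lemma utens_linear_ext (W : lmodType C) (g h : {linear utpow T -> W}) :
  (forall a, g (utens T a) = h (utens T a)) -> g =1 h.
Proof.
move=> gh; elim/utens_linear_ind => [k x y gx gy|]; last exact: gh.
by rewrite !linearP gx gy.
Qed.

Lemma utensM a b : utens T (a * b)%g = utens T a * utens T b.
Proof. by apply/val_inj; rewrite /= /circle_tens tensM. Qed.

Lemma utens1 : utens T 1%g = 1.
Proof. by apply/val_inj; rewrite /= -tens1. Qed.

Lemma circle_conj (t : circle C) : (circle_val t)^* = (t^-1)%g.
Proof.
apply: (mulfI (circle_neq0 t)); rewrite /= mulfV ?circle_neq0//.
by rewrite -normCK normr_circle expr1n.
Qed.

Lemma utens_star a : star (utens T a) = utens T a^-1%g.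
Proof.
apply/val_inj; rewrite /= /circle_tens tens_star; congr tens.
by apply/funext => i; exact: circle_conj.
Qed.

Variable phi : {multiplicative circles -> circle C}.
Hypothesis phiP : extends_prod phi.

(** Chosen for every complex family, since the universal property calls for a form on all of
    [I -> C]. *)
Definition sector_repr (c : I -> C) : circles :=
  xget (1%g : circles) [set a : circles | cofin_eq c (fun i => a i : C)].

(** Equivalent families have the same set of unitary candidates, from which [xget] makes the same
    choice. *)
Lemma sector_repr_eq (c d : I -> C) : cofin_eq c d ->
  sector_repr c = sector_repr d.
Proof.
move=> cd; congr xget; apply/seteqP; split=> a /=.
  by apply: cofin_eq_trans; exact: cofin_eqC.
exact: cofin_eq_trans.
Qed.

Lemma sector_reprP a : cofin_eq a (sector_repr (fun i => a i : C)).
Proof.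
have := xgetPex (1%g : circles) (ex_intro
  [set b : circles | cofin_eq (fun i => a i : C) (fun i => b i : C)]
  a (cofin_eqxx _)).
by apply: sub_finite_set => i /= ne /val_inj.
Qed.

(** In [a = (a / b) * b] the first factor is finitely supported, so [phi] takes it to its
    product. *)
Lemma phi_cofin a b : cofin_eq a b ->
  circle_val (phi a) =
  finprod (fun i => (a i : C) / (b i : C)) * circle_val (phi b).
Proof.
move=> ab; have ab1 : cofin_eq (a / b)%g 1%g.
  apply: sub_finite_set ab => i /= ne e; apply: ne.
  by rewrite -[LHS]/(a i / b i)%g e mulgV.
rewrite -[in LHS](mulgVK b a) gmulfM /= (phiP ab1) finprodE//.
exact: cofin_eq_circle ab1.
Qed.

(* If c lies in no sector then sector_repr c is the junk value 1, and finprod c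
   is 0. *)
Definition sector_form (c : I -> C) : gralg C Omega :=
  finprod (fun i => c i / (sector_repr c i : C)) *:
  (circle_val (phi (sector_repr c)) *:
   gr_lambda C (omega_class (sector_repr c))).

(** Changing one coordinate preserves the representative, so linearity reduces to that of
    [finprod]. *)
Lemma multilinear_sector_form : multilinear sector_form.
Proof.
move=> c i k x y; rewrite /sector_form.
have rE z : sector_repr (dfwith c i z) = sector_repr c.
  by apply: sector_repr_eq; exact: cofin_eq_dfwith.
rewrite !rE {rE}.
set r := sector_repr c.
have divE z : (fun j => dfwith c i z j / (r j : C)) =
    dfwith (fun j => c j / (r j : C)) i (z / (r i : C)).
  apply/funext => j; have [<-|ij] := eqVneq i j; first by rewrite !dfwithin.
  by rewrite !dfwithout.
have fE :
    finprod (dfwith (fun j => c j / (r j : C)) i ((k * x + y) / (r i : C)))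
    = k * finprod (dfwith (fun j => c j / (r j : C)) i (x / (r i : C)))
      + finprod (dfwith (fun j => c j / (r j : C)) i (y / (r i : C))) :> C.
  by rewrite mulrDl -mulrA; exact: multilinear_finprod.
by rewrite !divE fE scalerDl -[in LHS]scalerA.
Qed.

Lemma sector_form_circle a :
  sector_form (fun i => a i : C) =
  circle_val (phi a) *: gr_lambda C (omega_class a).
Proof.
rewrite /sector_form; set r := sector_repr _.
have ar : cofin_eq a r := sector_reprP a.
by rewrite scalerA -(phi_cofin ar) ((omega_classP a r).2 ar).
Qed.

Lemma utens_cofin a b : cofin_eq a b ->
  utens T a = (circle_val (phi a) / circle_val (phi b)) *: utens T b.
Proof.
move=> ab; rewrite (phi_cofin ab) mulfK ?circle_neq0//.
apply/val_inj; rewrite /= /circle_tens.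
apply: multilinear_cofin; first exact: tens_multilinear.
  by move=> i; exact: circle_neq0.
exact: cofin_eq_map ab.
Qed.

Lemma utpow_gralg_iso : exists Phi : {linear utpow T -> gralg C Omega},
  (forall a, Phi (utens T a) =
     circle_val (phi a) *: gr_lambda C (omega_class a)) /\
  star_isomorphism Phi.
Proof.
(* [g] lives on the whole tensor power; [Phi] is its restriction to the unitary part. *)
have [g gE _] := tens_universal T multilinear_sector_form.
have [Phi PhiE] : exists Phi : {linear utpow T -> gralg C Omega}, forall a,
    Phi (utens T a) = circle_val (phi a) *: gr_lambda C (omega_class a).
  by exists (g \o val) => a; rewrite /= gE sector_form_circle.
exists Phi; split=> //.
have PhiM x y : Phi (x * y) = Phi x * Phi y.
  move: y; elim/utens_linear_ind: x => [k x x' Px Px' y|a].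
    by rewrite mulrDl -scalerAl !linearP Px Px' mulrDl scalerAl.
  elim/utens_linear_ind => [k y y' Py Py'|b].
    by rewrite mulrDr -scalerAr !linearP Py Py' mulrDr scalerAr.
  rewrite -utensM !PhiE -scalerAl -scalerAr scalerA gmulfM.
  congr (_ *: _); rewrite -omega_mulE.
  by rewrite [RHS]gralgMUU mulr1.
have Phi1 : Phi 1 = 1 by rewrite -utens1 PhiE multiplicative1 scale1r.
split.
- by split.
- elim/utens_linear_ind => [k x y Px Py|a].
    by rewrite starD starZ !linearP /= Px Py starD starZ.
  rewrite utens_star !PhiE starZ circle_conj multiplicativeV; congr (_ *: _).
  by rewrite [RHS]gralg_starU conjC1 /gr_lambda -omega_invE.
(* The inverse sends a basis element to the normalized tensor of its representative; by
   [utens_cofin] this vector depends only on the class. *)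
have [Psi PsiE] : exists Psi : {linear gralg C Omega -> utpow T},
    forall w : Omega, Psi (gr_lambda C w) =
    (circle_val (phi (repr w)))^-1 *: utens T (repr w).
  exists (gralg_lift (fun w : Omega =>
    (circle_val (phi (repr w)))^-1 *: utens T (repr w))).
  exact: gralg_lift_lambda.
exists Psi.
  apply: (@utens_linear_ext _ (Psi \o Phi) idfun) => a.
  rewrite [LHS]/= PhiE linearZ /= PsiE scalerA -utens_cofin//.
  by apply/omega_classP; rewrite [RHS]reprK.
apply: (@gralg_linear_ext _ _ _ (Phi \o Psi) idfun) => w.
rewrite [LHS]/= PsiE linearZ /= PhiE scalerA mulVf ?circle_neq0// scale1r.
by congr gr_lambda; exact: reprK.
Qed.

End UnitaryPower.

Theorem corollary3p4 (R : realType) (I : choiceType)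
    (infI : infinite_set [set: I]) (T : tensorPower R[i] I) :
  (exists phi : {multiplicative (I -> circle R[i]) -> circle R[i]},
     extends_prod phi) /\
  (forall phi : {multiplicative (I -> circle R[i]) -> circle R[i]},
     extends_prod phi ->
     exists Phi : {linear utpow T -> gralg R[i] (Omega_ut R[i] I)},
       [/\ forall a : I -> circle R[i],
             Phi (utens T a) =
             circle_val (phi a) *: gr_lambda R[i] (omega_class a),
           forall Psi : {linear utpow T -> gralg R[i] (Omega_ut R[i] I)},
             (forall a : I -> circle R[i],
                Psi (utens T a) =
                circle_val (phi a) *: gr_lambda R[i] (omega_class a)) ->
             Psi =1 Phi
         & star_isomorphism Phi]).
Proof.
split=> [|phi phiP]; first exact: extends_prod_exists.
have [Phi [PhiE PhiI]] := utpow_gralg_iso T phiP.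
exists Phi; split=> // Psi PsiE; apply: utens_linear_ext => a.
by rewrite PsiE PhiE.
Qed.
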